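(* Let $V\subset\mathbb{P}^n$ be a variety and let $P\in\mathbb{P}^n\setminus\Delta_{n-1}$. If $f_1,\dots,f_s\in\mathbb{C}[x_0,\dots,x_n]$ are homogeneous polynomials generating the ideal $I(V)$, that is $I(V)=\langle f_1,\dots,f_s\rangle$, then $f_1^{\star P},\dots,f_s^{\star P}$ is a generating set for $I(P\star V)$. Moreover, if $f_1,\dots,f_s$ is a Gröbner basis for $I(V)$ with respect to a monomial order, then $f_1^{\star P},\dots,f_s^{\star P}$ is a Gröbner basis for $I(P\star V)$ with respect to the same monomial order.
   Context: We work over $\mathbb{C}$. $\Delta_{n-1}\subset\mathbb{P}^n$ is the union of the coordinate hyperplanes $x_i=0$, $i=0,\dots,n$, so points of $\mathbb{P}^n\setminus\Delta_{n-1}$ are those with all coordinates nonzero. For a variety $V\subset\mathbb{P}^n$, $I(V)$ denotes its homogeneous ideal in $\mathbb{C}[x_0,\dots,x_n]$. For points $p=[a_0:\cdots:a_n]$ and $q=[b_0:\cdots:b_n]$ of $\mathbb{P}^n$ with $a_ib_i\neq 0$ for some $i$, put $p\star q=[a_0b_0:\cdots:a_nb_n]$; if $a_ib_i=0$ for all $i$, then $p\star q$ is not defined. For varieties $V,W\subset\mathbb{P}^n$, $V\star W$ is the Zariski closure of $\{p\star q: p\in V,\ q\in W,\ p\star q \text{ is defined}\}$; $P\star V$ means $\{P\}\star V$. For $I=(i_0,\dots,i_n)\in\mathbb{N}^{n+1}$ write $X^I=x_0^{i_0}\cdots x_n^{i_n}$, $|I|=i_0+\cdots+i_n$, and for $P=[p_0:\cdots:p_n]$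 write $P^I=p_0^{i_0}\cdots p_n^{i_n}$. For a homogeneous polynomial $f=\sum_{|I|=d}a_IX^I$ of degree $d$ and $P\in\mathbb{P}^n\setminus\Delta_{n-1}$ (with a fixed choice of homogeneous coordinates), the Hadamard transformation of $f$ by $P$ is $$f^{\star P}=\sum_{|I|=d}\frac{a_I}{P^I}X^I,$$ which changes only by a nonzero scalar when the homogeneous coordinates of $P$ are rescaled. *)

(* Defs.v *)
From mathcomp Require Import all_boot all_order all_algebra generic_quotient.
From mathcomp Require Import mpoly.
From mathcomp Require Import boolp classical_sets reals complex.
Set Implicit Arguments.
Unset Strict Implicit.
Unset Printing Implicit Defensive.

Import GRing.Theory.
Local Open Scope ring_scope.
Local Open Scope quotient_scope.
Local Open Scope classical_set_scope.

Section ProjectiveSpace.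
Variables (K : fieldType) (n : nat).

Definition hcoord := {v : 'rV[K]_n.+1 | v != 0}.

Definition proportional (u v : hcoord) : bool :=
  `[< exists2 c : K, c != 0 & val u = c *: val v >].

Lemma proportional_refl : reflexive proportional.
Proof. by move=> u; apply/asboolP; exists 1; rewrite ?oner_eq0 ?scale1r. Qed.

Lemma proportional_sym : ssrbool.symmetric proportional.
Proof.
suff sub u v : proportional u v -> proportional v u.
  by move=> u v; apply/idP/idP; apply: sub.
move=> /asboolP [c c0 uv]; apply/asboolP; exists c^-1; first by rewrite invr_eq0.
by rewrite uv scalerA mulVf ?scale1r.
Qed.

Lemma proportional_trans : transitive proportional.
Proof.
move=> v u w /asboolP [c c0 uv] /asboolP [d d0 vw]; apply/asboolP.
by exists (c * d); rewrite ?mulf_neq0 // uv vw scalerA.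
Qed.

Canonical proportional_equiv :=
  EquivRel proportional proportional_refl proportional_sym proportional_trans.

Definition projsp := {eq_quot proportional_equiv}.

Definition proj_point (v : hcoord) : projsp := \pi_projsp v.

Lemma proj_pointP (u v : hcoord) :
  proj_point u = proj_point v <-> exists2 c : K, c != 0 & val u = c *: val v.
Proof.
split=> [/eqP | uv]; first by rewrite /proj_point eqmodE => /asboolP.
by apply/eqP; rewrite /proj_point eqmodE; apply/asboolP.
Qed.

Lemma proj_point_repr (P : projsp) : proj_point (repr P) = P.
Proof. exact: reprK. Qed.

Definition hmul (u v : 'rV[K]_n.+1) : 'rV[K]_n.+1 :=
  \row_i (u ord0 i * v ord0 i).

(* [None] when the product is undefined, i.e. all coordinates of it vanish. *)
Definition hadamard_point (P Q : projsp) : option projsp :=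
  omap proj_point (insub (hmul (val (repr P)) (val (repr Q)))).

Lemma hadamard_pointE (u v : hcoord) :
  hadamard_point (proj_point u) (proj_point v) =
  omap proj_point (insub (hmul (val u) (val v))).
Proof.
rewrite /hadamard_point.
have [c c0 ->] := (proj_pointP _ _).1 (proj_point_repr (proj_point u)).
have [d d0 ->] := (proj_pointP _ _).1 (proj_point_repr (proj_point v)).
have -> : hmul (c *: val u) (d *: val v) = (c * d) *: hmul (val u) (val v).
  by apply/rowP => i; rewrite !mxE mulrACA.
have cd0 : c * d != 0 by rewrite mulf_neq0.
set h := hmul (val u) (val v).
have eq0 : ((c * d) *: h != 0) = (h != 0) by rewrite scaler_eq0 (negPf cd0).
case: (insubP _ ((c * d) *: h)) => [w | ]; rewrite eq0 => h0; last first.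
  by rewrite insubN.
move=> ew; rewrite (insubT (fun x => x != 0) h0) /=.
by congr Some; apply/proj_pointP; exists (c * d).
Qed.

Definition homogeneous (f : {mpoly K[n.+1]}) : Prop :=
  exists d : nat, f \is d.-homog.

Definition vanishes (f : {mpoly K[n.+1]}) (P : projsp) : Prop :=
  forall v : hcoord, proj_point v = P -> f.@[val v ord0] = 0.

Definition zero_locus (S : set {mpoly K[n.+1]}) : set projsp :=
  [set P | forall f, S f -> vanishes f P].

Definition zariski_closed (V : set projsp) : Prop :=
  exists S : set {mpoly K[n.+1]},
    (forall f, S f -> homogeneous f) /\ V = zero_locus S.

Definition zariski_closure (A : set projsp) : set projsp :=
  \bigcap_(V in [set V | zariski_closed V /\ A `<=` V]) V.

Definition hadamard_product (V W : set projsp) : set projsp :=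
  zariski_closure
    [set R | exists P Q, [/\ V P, W Q & hadamard_point P Q = Some R]].

Definition coordinate_hyperplanes : set projsp :=
  \bigcup_(i in [set: 'I_n.+1]) zero_locus [set 'X_i].

End ProjectiveSpace.

Definition ideal_generated (A : comNzRingType) (S : set A) : set A :=
  [set x | exists (k : nat) (a g : 'I_k -> A),
     (forall i, S (g i)) /\ x = \sum_(i < k) a i * g i].

Definition homogeneous_ideal (K : fieldType) (n : nat)
    (V : set (projsp K n)) : set {mpoly K[n.+1]} :=
  ideal_generated
    [set f | homogeneous f /\ forall P, V P -> vanishes f P].

Definition mnm_eval (K : fieldType) (n : nat) (p : 'rV[K]_n.+1)
    (m : 'X_{1..n.+1}) : K :=
  \prod_(i < n.+1) p ord0 i ^+ m i.

Definition hadamard_transform (K : fieldType) (n : nat) (p : 'rV[K]_n.+1)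
    (f : {mpoly K[n.+1]}) : {mpoly K[n.+1]} :=
  \sum_(m <- msupp f) (f@_m / mnm_eval p m) *: 'X_[m].

(* An arbitrary monomial order; the order carried by ['X_{1..n}] in the library
   is a fixed one and plays no role here. *)
Record monomial_order (n : nat) (le : rel 'X_{1..n}) : Prop := MonomialOrder {
  monord_refl : reflexive le;
  monord_anti : antisymmetric le;
  monord_trans : transitive le;
  monord_total : total le;
  monord_add : forall m m1 m2, le m1 m2 -> le (m1 + m)%MM (m2 + m)%MM;
  monord_well : forall A : set 'X_{1..n}, A !=set0 ->
    exists2 m, A m & forall m', A m' -> le m m' }.

(* The zero polynomial has no leading term and thus contributes nothing. *)
Definition leading_terms (K : fieldType) (n : nat) (le : rel 'X_{1..n})
    (S : set {mpoly K[n]}) : set {mpoly K[n]} :=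
  [set t | exists f m,
     [/\ S f, m \in msupp f, forall m', m' \in msupp f -> le m' m
       & t = f@_m *: 'X_[m]]].

Definition groebner_basis (K : fieldType) (n s : nat) (le : rel 'X_{1..n})
    (I : set {mpoly K[n]}) (f : 'I_s -> {mpoly K[n]}) : Prop :=
  (forall i, I (f i)) /\
  ideal_generated (leading_terms le I) =
  ideal_generated (leading_terms le (range f)).

(* Main.v *)
(** Dividing the coefficient of [X^I] by [P^I] is the ring automorphism
    [x_i |-> x_i / p_i] of the polynomial ring. It multiplies each monomial by a
    nonzero scalar, so it preserves homogeneity, supports and leading terms, and
    [f^{*P}] takes at [P * Q] the value of [f] at [Q]. Hence it carries the
    homogeneous polynomials vanishing on [V] onto those vanishing on the points
    [P * Q], [Q] in [V]; passing to the Zariski closure adds no condition. *)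
From HB Require Import structures.
Require Import Defs.
From mathcomp Require Import all_boot all_order all_algebra.
From mathcomp Require Import mpoly.
From mathcomp Require Import boolp classical_sets reals complex.
Import GRing.Theory.
Local Open Scope ring_scope.
Local Open Scope classical_set_scope.

(** The section [psi] lifts the coefficients of a combination to [A], while its generators are
    lifted to chosen preimages in [S]. *)
Lemma ideal_generated_image {A B : comNzRingType} (phi : {rmorphism A -> B})
    (psi : B -> A) (S : set A) :
  cancel psi phi ->
  ideal_generated (phi @` S) = phi @` ideal_generated S.
Proof.
move=> psiK; apply/seteqP; split=> [x [k [a [g [gS ->]]]] | _ [x + <-]].
- have /choice [h hP] i : exists y, S y /\ phi y = g i.
    by have [y Sy <-] := gS i; exists y.
  exists (\sum_(i < k) psi (a i) * h i).
    by exists k, (psi \o a), h; split=> // i; have [] := hP i.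
  rewrite rmorph_sum; apply: eq_bigr => i _.
  by rewrite rmorphM psiK; have [_ ->] := hP i.
- move=> [k [a [g [gS ->]]]]; exists k, (phi \o a), (phi \o g); split=> [i|].
    by exists (g i).
  by rewrite rmorph_sum; apply: eq_bigr => i _; rewrite rmorphM.
Qed.

(** The zero locus of a homogeneous polynomial vanishing on [A] is one of the closed sets whose
    intersection is the closure. *)
Lemma homogeneous_ideal_closure (K : fieldType) (n : nat)
    (A : set (projsp K n)) :
  homogeneous_ideal (zariski_closure A) = homogeneous_ideal A.
Proof.
congr ideal_generated; apply/seteqP; split=> f [fh fA]; split=> //.
- by move=> P AP; apply: fA => W [_]; apply.
- move=> P clAP; suff: zero_locus [set f] P by apply.
  apply: clAP; split=> [|Q AQ _ ->]; last exact: fA.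
  by exists [set f]; split=> // _ ->.
Qed.

Lemma coord_neq0 (K : fieldType) (n : nat) (p : hcoord K n) :
  ~ coordinate_hyperplanes (proj_point p) -> forall i, val p ord0 i != 0.
Proof.
move=> pN i; apply/negP => /eqP pi0; apply: pN; exists i => // _ -> v.
by move=> /proj_pointP [c _ ->]; rewrite mevalXU mxE pi0 mulr0.
Qed.

Section HadamardTransform.
Context {K : fieldType} {n : nat}.
Implicit Types (p v : 'rV[K]_n.+1) (f : {mpoly K[n.+1]}) (m : 'X_{1..n.+1}).

Lemma mcoeff_hadamard p f m :
  (hadamard_transform p f)@_m = f@_m / mnm_eval p m.
Proof.
rewrite /hadamard_transform raddf_sum /=.
under eq_bigr do rewrite mcoeffZ mcoeffX.
have [mf|mf] := boolP (m \in msupp f).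
  rewrite (bigD1_seq m) //= eqxx mulr1 big1 ?addr0 // => m' /negPf ->.
  by rewrite mulr0.
rewrite (memN_msupp_eq0 mf) mul0r big_seq big1 // => m' m'f.
by case: eqP mf => [<-|]; rewrite ?m'f ?mulr0.
Qed.

(** Written as a substitution, so that the ring morphism structure comes from [mmap]; the
    coefficientwise formula does not exhibit multiplicativity. *)
Definition scale_vars p : {mpoly K[n.+1]} -> {mpoly K[n.+1]} :=
  mmap (@mpolyC n.+1 K) (fun i => (p ord0 i)^-1 *: 'X_i).

HB.instance Definition _ p := GRing.RMorphism.on (scale_vars p).

(** Inversion in a field commutes with products and powers, even at zero, where [0^-1 = 0]. *)
Lemma hadamard_transformE p : hadamard_transform p = scale_vars p.
Proof.
apply/funext => f; apply: eq_bigr => m _.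
rewrite mul_mpolyC -scalerA; congr (_ *: _).
rewrite /mmap1 /mnm_eval -prodfV mpolyXE_id -scaler_prod.
by apply: eq_bigr => i _; rewrite exprZn exprVn.
Qed.

(** At [hmul p v] each monomial gains the factor [mnm_eval p m], which cancels the denominator. *)
Lemma meval_hadamard p v f : (forall i, p ord0 i != 0) ->
  (hadamard_transform p f).@[hmul p v ord0] = f.@[v ord0].
Proof.
move=> p0; rewrite [RHS]mevalE raddf_sum /=; apply: eq_bigr => m _.
rewrite mevalZ mevalX -mulrA; congr (_ * _).
rewrite /mnm_eval -prodfV -big_split /=; apply: eq_bigr => i _.
by rewrite mxE exprMn mulKf // expf_neq0.
Qed.

End HadamardTransform.

Section Nonvanishing.
Context {K : fieldType} {n : nat} {p : 'rV[K]_n.+1}.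
Hypothesis p0 : forall i, p ord0 i != 0.
Implicit Types (f : {mpoly K[n.+1]}) (m : 'X_{1..n.+1}).

Let T := hadamard_transform p.

Lemma mnm_eval_neq0 m : mnm_eval p m != 0.
Proof. by apply/prodf_neq0 => i _; rewrite expf_neq0. Qed.

(** The denominators at [p] and at its coordinatewise inverse multiply to 1. This makes [T]
    surjective and supplies the section used to transport ideals. *)
Lemma hadamard_transformK :
  cancel (hadamard_transform (\row_i (p ord0 i)^-1)) T.
Proof.
move=> f; apply/mpolyP => m; rewrite !mcoeff_hadamard -mulrA -invfM.
rewrite /mnm_eval -big_split big1 ?invr1 ?mulr1 //= => i _.
by rewrite mxE -exprMn mulVf ?expr1n.
Qed.

Lemma msupp_hadamard f : msupp (T f) =i msupp f.
Proof.
move=> m; rewrite !mcoeff_msupp mcoeff_hadamard mulf_eq0 invr_eq0.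
by rewrite (negPf (mnm_eval_neq0 m)) orbF.
Qed.

Lemma homogeneous_hadamard f : homogeneous (T f) <-> homogeneous f.
Proof.
by split=> -[d /dhomogP fd]; exists d; apply/dhomogP => m mf; apply: fd;
  rewrite msupp_hadamard in mf *.
Qed.

Lemma ideal_generated_hadamard (S : set {mpoly K[n.+1]}) :
  ideal_generated (T @` S) = T @` ideal_generated S.
Proof.
move: hadamard_transformK; rewrite /T (hadamard_transformE p).
exact: (ideal_generated_image (scale_vars p)).
Qed.

(** Supports agree, so [f] and [T f] have the same leading monomial; [TX] matches the
    coefficients. *)
Lemma leading_terms_hadamard (le : rel 'X_{1..n.+1})
    (S : set {mpoly K[n.+1]}) :
  leading_terms le (T @` S) = T @` leading_terms le S.
Proof.
have TX f m : T (f@_m *: 'X_[m]) = (T f)@_m *: 'X_[m].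
  apply/mpolyP => m'; rewrite mcoeff_hadamard !mcoeffZ mcoeffX mcoeff_hadamard.
  by case: eqP => [->|]; rewrite ?mulr1 // !mulr0 mul0r.
apply/seteqP; split=> [_ [_ [m [[f Sf <-] mf lem ->]]]
  | _ [_ [f [m [Sf mf lem ->]]] <-]].
- exists (f@_m *: 'X_[m]); last exact: TX.
  exists f, m; split=> //; first by rewrite -msupp_hadamard.
  by move=> m' m'f; apply: (lem m'); rewrite msupp_hadamard.
- exists (T f), m; split=> //.
  + by rewrite msupp_hadamard.
  + by move=> m'; rewrite msupp_hadamard => /lem.
Qed.

End Nonvanishing.

Section HadamardProduct.
Context {K : fieldType} {n : nat} {p : hcoord K n}.
Hypothesis p0 : forall i, val p ord0 i != 0.

(** Thus the Hadamard product of the point of [p] with any point is defined. *)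
Lemma hmul_neq0 (v : hcoord K n) : hmul (val p) (val v) != 0.
Proof.
have /rV0Pn [i vi0] := valP v.
by apply/rV0Pn; exists i; rewrite mxE mulf_neq0.
Qed.

Lemma hadamard_point_proj (v : hcoord K n) :
  hadamard_point (proj_point p) (proj_point v) =
  Some (proj_point (Sub (hmul (val p) (val v)) (hmul_neq0 v))).
Proof. by rewrite hadamard_pointE (insubT (fun x => x != 0) (hmul_neq0 v)). Qed.

Lemma vanishes_hadamard (V : set (projsp K n)) (f : {mpoly K[n.+1]}) :
  (forall R, [set R | exists P Q, [/\ [set proj_point p] P, V Q
      & hadamard_point P Q = Some R]] R ->
    vanishes (hadamard_transform (val p) f) R)
  <-> (forall Q, V Q -> vanishes f Q).
Proof.
split=> [Tf0 Q VQ v vQ | f0 R [_ [Q [-> VQ]]]].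
- rewrite -(meval_hadamard (val p)) //.
  pose w : hcoord K n := Sub (hmul (val p) (val v)) (hmul_neq0 v).
  apply: (Tf0 (proj_point w) _ w) => //.
  by exists (proj_point p), Q; split=> //; rewrite -vQ hadamard_point_proj.
- rewrite -(proj_point_repr Q); set v := repr Q.
  rewrite hadamard_point_proj => -[<-] w /proj_pointP [c c0 ->] /=.
  (* An arbitrary representative of the product differs from [hmul p v] by a scalar [c]; moving [c]
     onto [v] gives another representative of [Q], where [f] vanishes too. *)
  have cv0 : c *: val v != 0 by rewrite scaler_eq0 negb_or c0 (valP v).
  have -> : c *: hmul (val p) (val v) = hmul (val p) (c *: val v).
    by apply/rowP => i; rewrite !mxE mulrCA.
  rewrite meval_hadamard //.
  apply: (f0 Q VQ (Sub (c *: val v) cv0)); rewrite -(proj_point_repr Q).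
  by apply/proj_pointP; exists c.
Qed.

Lemma homogeneous_ideal_hadamard (V : set (projsp K n)) :
  homogeneous_ideal (hadamard_product [set proj_point p] V) =
  hadamard_transform (val p) @` homogeneous_ideal V.
Proof.
rewrite /hadamard_product homogeneous_ideal_closure /homogeneous_ideal.
rewrite -(ideal_generated_hadamard p0); congr ideal_generated.
apply/seteqP; split=> [g [gh g0] | _ [f [fh f0] <-]]; last first.
  by split; [apply/homogeneous_hadamard | apply/vanishes_hadamard].
(* Surjectivity: [g] is the transform of its own transform [f] by the inverse point, so the
   conditions on [g] become conditions on [f]. *)
have gE := hadamard_transformK p0 g; rewrite -gE in gh g0 *.
set f := hadamard_transform _ g in gh g0 *; exists f => //; split.
  exact/(homogeneous_hadamard p0).
exact/vanishes_hadamard.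
Qed.

End HadamardProduct.

Theorem theorem3p5 (R : realType) (n s : nat)
    (V : set (projsp R[i] n)) (P : projsp R[i] n) (p : hcoord R[i] n)
    (f : 'I_s -> {mpoly R[i][n.+1]}) :
  zariski_closed V ->
  ~ coordinate_hyperplanes P ->
  proj_point p = P ->
  (forall i : 'I_s, homogeneous (f i)) ->
  (homogeneous_ideal V = ideal_generated (range f) ->
   homogeneous_ideal (hadamard_product [set P] V) =
   ideal_generated (range (fun i : 'I_s => hadamard_transform (val p) (f i))))
  /\
  (forall le : rel 'X_{1..n.+1}, monomial_order le ->
   groebner_basis le (homogeneous_ideal V) f ->
   groebner_basis le (homogeneous_ideal (hadamard_product [set P] V))
     (fun i : 'I_s => hadamard_transform (val p) (f i))).
Proof.
move=> _ PN pP _; rewrite -pP in PN *.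
have p0 := coord_neq0 _ _ _ PN.
rewrite (homogeneous_ideal_hadamard p0).
have rangeE : range (fun i => hadamard_transform (val p) (f i)) =
    hadamard_transform (val p) @` range f by rewrite image_comp.
split=> [-> | le _ [fV gb]]; first by rewrite rangeE ideal_generated_hadamard.
split=> [i|]; first by exists (f i).
(* The transform commutes with taking leading terms and with generating ideals, so both sides become
   images of the two sides of [gb]. *)
by rewrite rangeE !leading_terms_hadamard // !ideal_generated_hadamard // gb.
Qed.
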